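(* Let $K$ be a monoid with submonoids $G$ and $H$ such that $K=G\bowtie H$. If $K$ is a Garside monoid, with Garside element $\Delta$, then $G$ and $H$ are parabolic submonoids of $K$. In particular, $G$ and $H$ are Garside monoids.
   Context: Zappa–Szép product: for a monoid $K$ with submonoids $G,H$, write $K=G\bowtie H$ if for every $k\in K$ there exist unique $g_1,g_2\in G$ and $h_1,h_2\in H$ such that $g_1h_1=k=h_2g_2$. Garside monoids: in a monoid $M$ with identity $\mathbf 1$, write $x\preccurlyeq y$ ($x$ is a prefix of $y$) if $y=xu$ for some $u\in M$, and $y\succcurlyeq x$ ($x$ is a suffix of $y$) if $y=ux$ for some $u\in M$. An atom is an element $a\neq\mathbf 1$ such that $a=uv$ implies $u=\mathbf 1$ or $v=\mathbf 1$. $M$ is atomic if it is generated by its atoms and for each $x\in M$ there is an upper bound on the lengths of decompositions of $x$ as a product of atoms. An element is balanced if its set of prefixes equals its set of suffixes; this common set is denoted $\mathrm{Div}(d)$. A Garside structure is a pair $(M,\Delta)$ where $M$ is a cancellative atomic monoid, the prefix and suffix relations are lattice orders, $\Delta\in M$ is balanced, $M$ is generated by $\mathrm{Div}(\Delta)$, and $\mathrm{Div}(\Delta)$ is finite. $M$ is a Garside monoid if such a $\Delta$ (a Garside element) exists. Elements of $\mathcal D=\mathrm{Div}(\Delta)$ are called simple. Parabolic submonoids: let $M$ be a Garside monoid with Garside element $\Delta$ and set of atoms $\mathcal A$. For a balanced simple element $\delta$ let $M_\delta$ be the submonoid generated by $\{a\in\mathcal A: a\preccurlyeq\delta\}$.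 $M_\delta$ is a parabolic submonoid of $M$ if $\{x\in M: x\preccurlyeq\delta\}=\mathcal D\cap M_\delta$. A submonoid is parabolic if it is of this form for some balanced simple $\delta$. *)

(* Defs.v *)
From HB Require Import structures.
From mathcomp Require Import all_boot.
From mathcomp Require Import boolp classical_sets cardinality.

Set Implicit Arguments.
Unset Strict Implicit.
Unset Printing Implicit Defensive.

Local Open Scope group_scope.
Local Open Scope classical_set_scope.

(* The carrier of a submonoid, as a monoid in its own right. The (unused) proof
   argument is what the monoid instance below is built from. *)
Definition submonoid_type (K : monoidType) (G : set K)
    (hG : monoid_closed [in G]) : Type := {x : K | x \in G}.

Section SubmonoidInstance.
Variables (K : monoidType) (G : set K) (hG : monoid_closed [in G]).

HB.instance Definition _ := SubChoice.on (submonoid_type hG).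
HB.instance Definition _ :=
  @SubChoice_isSubMonoid.Build K [in G] (submonoid_type hG) hG.
End SubmonoidInstance.

Definition generated (M : monoidType) (A : set M) : set M :=
  smallest [set B : set M | monoid_closed [in B]] A.

Definition zappa_szep (K : monoidType) (G H : set K) : Prop :=
  forall k : K,
    (exists! p : K * K, [/\ G p.1, H p.2 & p.1 * p.2 = k]) /\
    (exists! q : K * K, [/\ H q.1, G q.2 & q.1 * q.2 = k]).

Section Garside.
Variable M : monoidType.
Implicit Types (x y d Delta : M) (N : set M).

Definition is_prefix x y : Prop := exists u, y = x * u.
Definition is_suffix x y : Prop := exists u, y = u * x.

Definition atom : set M :=
  [set a | a <> 1 /\ forall u v, a = u * v -> u = 1 \/ v = 1].

Definition atomic : Prop :=
  generated atom = setT /\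
  forall x, exists n : nat, forall s : seq M,
    (forall a, a \in s -> atom a) -> \prod_(a <- s) a = x -> (size s <= n)%N.

Definition cancellative : Prop :=
  left_injective (@mul M) /\ right_injective (@mul M).

Definition Div d : set M := [set x | is_prefix x d].

Definition balanced d : Prop := Div d = [set x | is_suffix x d].

End Garside.

Record lattice_order (T : Type) (le : T -> T -> Prop) : Prop := LatticeOrder {
  lattice_refl : forall x, le x x;
  lattice_anti : forall x y, le x y -> le y x -> x = y;
  lattice_trans : forall x y z, le x y -> le y z -> le x z;
  lattice_meet : forall x y, exists m,
    [/\ le m x, le m y & forall z, le z x -> le z y -> le z m];
  lattice_join : forall x y, exists j,
    [/\ le x j, le y j & forall z, le x z -> le y z -> le j z]
}.

Record garside_structure (M : monoidType) (Delta : M) : Prop :=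
  GarsideStructure {
    garside_cancellative : cancellative M;
    garside_atomic : atomic M;
    garside_prefix_lattice : lattice_order (@is_prefix M);
    garside_suffix_lattice : lattice_order (@is_suffix M);
    garside_balanced : balanced Delta;
    garside_generated : generated (Div Delta) = setT;
    garside_finite : finite_set (Div Delta)
  }.

Definition garside_monoid (M : monoidType) : Prop :=
  exists Delta : M, garside_structure Delta.

Definition parabolic_gen (M : monoidType) (delta : M) : set M :=
  generated [set a | atom a /\ is_prefix a delta].

Definition parabolic (M : monoidType) (Delta : M) (N : set M) : Prop :=
  exists delta : M,
    [/\ balanced delta, Div Delta delta, N = parabolic_gen delta
      & Div delta = Div Delta `&` parabolic_gen delta].

(* Main.v *)
Require Import Defs.
From HB Require Import structures.
From mathcomp Require Import all_boot.
From mathcomp Require Import boolp classical_sets cardinality.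

(** Atomicity makes K conical, so uniqueness of the decompositions forces every
    factor of an element of G to lie in G. Writing k = g1 h1 = h2 g2, the element
    g1 is the greatest prefix of k in G and g2 its greatest suffix in G. For
    k = Delta the prefixes of g1 are thus the simple elements of G, and so are the
    suffixes of g2; hence g1 is a suffix of g2, which is a prefix of g1, and
    atomicity gives g1 = g2. This element is the balanced element defining G as a
    parabolic submonoid. Since G is closed under factors and every element of K has
    a greatest prefix and a greatest suffix in G, meets and joins in K of elements
    of G stay in G. *)

Set Implicit Arguments.
Unset Strict Implicit.
Unset Printing Implicit Defensive.

Local Open Scope group_scope.
Local Open Scope classical_set_scope.

(** * Generated submonoids and words in their generators *)

Lemma monoid_closedP (M : monoidType) (B : set M) :
  monoid_closed [in B] <-> B 1 /\ forall x y, B x -> B y -> B (x * y).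
Proof.
split=> [[B1 BM]|[B1 BM]].
  by split=> [|x y Bx By]; apply: set_mem => //; apply: BM; apply: mem_set.
split; first exact: mem_set.
by move=> x y /set_mem Bx /set_mem By; apply/mem_set/BM.
Qed.

Lemma prod_closed (M : monoidType) (B : set M) (s : seq M) :
  monoid_closed [in B] -> (forall a, a \in s -> B a) -> B (\prod_(a <- s) a).
Proof.
move=> /monoid_closedP[B1 BM]; elim: s => [|a s IHs] sB; first by rewrite big_nil.
rewrite big_cons; apply: BM; first by apply: sB; rewrite mem_head.
by apply: IHs => b bs; apply: sB; rewrite in_cons bs orbT.
Qed.

Lemma generated_subset (M : monoidType) (A B : set M) :
  monoid_closed [in B] -> A `<=` B -> generated A `<=` B.
Proof. by move=> clB AB x; apply; split. Qed.

Lemma generated_closed (M : monoidType) (A : set M) :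
  monoid_closed [in generated A].
Proof.
apply/monoid_closedP; split=> [B [/monoid_closedP[]]|x y Ax Ay B clAB] //.
have [/monoid_closedP[_ BM] _] := clAB.
by apply: BM; [exact: Ax|exact: Ay].
Qed.

Lemma mem_generated (M : monoidType) (A : set M) : A `<=` generated A.
Proof. by move=> x Ax B [_]; apply. Qed.

(** Replaces the intersection defining [generated] by explicit words, on which one can argue by
    induction. *)
Lemma generatedP (M : monoidType) (A : set M) (x : M) :
  generated A x <-> exists2 s : seq M, (forall a, a \in s -> A a) & \prod_(a <- s) a = x.
Proof.
split=> [|[s sA <-]]; last first.
  apply: prod_closed => [|a /sA]; [exact: generated_closed | exact: mem_generated].
move: x; apply: generated_subset => [|x Ax]; last first.
  by exists [:: x]; [move=> a /[!inE]/eqP-> | rewrite big_seq1].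
apply/monoid_closedP; split; first by exists [::]; rewrite ?big_nil.
move=> _ _ [s sA <-] [t tA <-]; exists (s ++ t); last by rewrite big_cat.
by move=> a; rewrite mem_cat => /orP[/sA|/tA].
Qed.

(** Split off the head of the word: either it is [1] and the tail still multiplies to [a], or the
    tail is trivial and the head is [a]. *)
Lemma atom_mem_prod (M : monoidType) (a : M) (s : seq M) :
  atom a -> \prod_(b <- s) b = a -> a \in s.
Proof.
move=> [a1 atom_a]; elim: s => [|b s IHs]; rewrite ?big_nil ?big_cons.
  by move=> /esym.
move=> def_a; have [b1|s1] := atom_a _ _ (esym def_a); rewrite in_cons.
  by rewrite IHs ?orbT // -def_a b1 mul1g.
by rewrite -def_a s1 mulg1 eqxx.
Qed.

(** * Atomic monoids: no nontrivial self-embedding, conicality *)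

Section Atomic.
Variable M : monoidType.
Hypothesis atomicM : atomic M.

Lemma atomic_decomp (x : M) :
  exists2 s : seq M, (forall a, a \in s -> atom a) & \prod_(a <- s) a = x.
Proof. by apply/generatedP; rewrite atomicM.1. Qed.

(* Otherwise x = u^n x v^n would have arbitrarily long decompositions. *)
Lemma atomic_mul_eq (u x v : M) : x = u * x * v -> u = 1 /\ v = 1.
Proof.
move=> def_x.
have [su su_atom def_u] := atomic_decomp u.
have [sv sv_atom def_v] := atomic_decomp v.
have [suv0|suv_gt0] := posnP (size su + size sv).
  move/eqP: suv0; rewrite addn_eq0 !size_eq0 => /andP[/eqP su0 /eqP sv0].
  by rewrite -def_u -def_v su0 sv0 !big_nil.
have [n bound_n] := atomicM.2 x.
suff [s s_atom [def_s n_lt_s]] : exists2 s : seq M, (forall a, a \in s -> atom a) &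
    \prod_(a <- s) a = x /\ (n < size s)%N.
  by have := bound_n s s_atom def_s; rewrite leqNgt n_lt_s.
elim: n.+1 => [|m [s s_atom [def_s m_le_s]]].
  by have [s s_atom def_s] := atomic_decomp x; exists s.
exists (su ++ s ++ sv).
  by move=> a; rewrite !mem_cat => /or3P[/su_atom|/s_atom|/sv_atom].
rewrite !big_cat /= def_u def_s def_v mulgA -def_x; split=> //.
by rewrite !size_cat addnCA -addn1 leq_add.
Qed.

Lemma atomic_conical (x y : M) : x * y = 1 -> x = 1 /\ y = 1.
Proof. by move=> xy1; apply: (@atomic_mul_eq x 1 y); rewrite mulg1. Qed.

End Atomic.

(** * Lattice orders inherited by subsets *)

Definition factor_closed (M : monoidType) (G : set M) : Prop :=
  forall x y, G (x * y) -> G x /\ G y.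

Definition greatest_below (T : Type) (le : T -> T -> Prop) (G : set T) (k g : T) : Prop :=
  [/\ G g, le g k & forall x, G x -> le x k -> le x g].

(** Meets stay in [G] because [G] is downward closed. For joins, the greatest element of [G] below
    the join serves as a bound in [G]. *)
Lemma lattice_order_sub (T U : Type) (f : U -> T) (G : set T)
    (le : T -> T -> Prop) (leU : U -> U -> Prop) :
  injective f -> range f = G -> (forall x y, leU x y <-> le (f x) (f y)) ->
  (forall x y, G y -> le x y -> G x) ->
  (forall k, exists g, greatest_below le G k g) ->
  lattice_order le -> lattice_order leU.
Proof.
move=> f_inj rangef leUE downG greatestG [le_refl le_anti le_trans meetT joinT].
have {}leUE x y : leU x y = le (f x) (f y) by exact/propext.
have Gf x : G (f x) by rewrite -rangef; exists x.
split=> [x|x y|x y z|x y|x y]; rewrite ?leUE //.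
- by move=> xy yx; apply/f_inj/le_anti.
- exact: le_trans.
- have [m [mx my max_m]] := meetT (f x) (f y).
  have := downG _ _ (Gf x) mx; rewrite -{1}rangef => -[m' _ def_m].
  exists m'; rewrite !leUE def_m; split=> // z.
  by rewrite !leUE def_m; apply: max_m.
- have [j [xj yj min_j]] := joinT (f x) (f y).
  have [g [Gg gj max_g]] := greatestG j.
  (* [f x] and [f y] lie in [G] below [j], hence below [g]; so [g] is an upper bound and dominates
     the join [j]. *)
  have jg : le j g by apply: min_j; apply: max_g.
  have := downG _ _ Gg jg; rewrite -{1}rangef => -[j' _ def_j].
  exists j'; rewrite !leUE def_j; split=> // z.
  by rewrite !leUE def_j; apply: min_j.
Qed.

(** * Factor-closed submonoids of a Garside monoid *)

Section FactorClosed.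
Variables (K : monoidType) (G : set K) (hG : monoid_closed [in G]).
Hypothesis facG : factor_closed G.
Let S : monoidType := submonoid_type hG.
Implicit Types (x y : S) (k : K).

Lemma submonoidP x : G (val x).
Proof. exact: set_mem (valP x). Qed.

Lemma submonoid_lift k : G k -> exists x : S, val x = k.
Proof. by move=> /mem_set Gk; exists (Sub k Gk); rewrite SubK. Qed.

Lemma range_submonoid_val : range (val : S -> K) = G.
Proof.
apply/seteqP; split=> [_ [x _ <-]|k /submonoid_lift[x <-]]; last by exists x.
exact: submonoidP.
Qed.

(** The cofactor, taken in [K], is a factor of an element of [G] and so lies in [G]. *)
Lemma is_prefix_val x y : is_prefix x y <-> is_prefix (val x) (val y).
Proof.
split=> [[u ->]|[k def_y]]; first by exists (val u); rewrite valM.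
have [|_ /submonoid_lift[u def_k]] := @facG (val x) k.
  by rewrite -def_y; apply: submonoidP.
by exists u; apply: val_inj; rewrite valM def_k.
Qed.

Lemma is_suffix_val x y : is_suffix x y <-> is_suffix (val x) (val y).
Proof.
split=> [[u ->]|[k def_y]]; first by exists (val u); rewrite valM.
have [|/submonoid_lift[u def_k] _] := @facG k (val x).
  by rewrite -def_y; apply: submonoidP.
by exists u; apply: val_inj; rewrite valM def_k.
Qed.

Lemma atom_val x : atom x <-> atom (val x).
Proof.
have valE1 y : val y = 1 <-> y = 1.
  by split=> [y1|->]; [apply: val_inj; rewrite val1|rewrite val1].
split=> [[x1 atom_x]|[x1 atom_x]]; split; try by move=> /valE1.
  move=> k l def_x; have [|Gk Gl] := @facG k l; first by rewrite -def_x; apply: submonoidP.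
  have [[u def_u] [v def_v]] := (submonoid_lift Gk, submonoid_lift Gl).
  rewrite -def_u -def_v !valE1; apply: atom_x; apply: val_inj.
  by rewrite valM def_u def_v.
move=> u v def_x; have := atom_x (val u) (val v).
by rewrite -valM -def_x !valE1; apply.
Qed.

(** By factor closure, every letter of a word for [val x] already lies in [G], so the whole word
    lifts to [S]. *)
Lemma generated_val (A : set K) x :
  generated A (val x) -> generated ((val : S -> K) @^-1` A) x.
Proof.
move=> /generatedP[s]; elim: s x => [|a s IHs] x sA; rewrite ?big_nil ?big_cons => def_x.
  have -> : x = 1 by apply: val_inj; rewrite val1.
  by have /monoid_closedP[] := generated_closed ((val : S -> K) @^-1` A).
have [|Ga Gs] := @facG a (\prod_(b <- s) b); first by rewrite def_x; apply: submonoidP.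
have [[u def_u] [v def_v]] := (submonoid_lift Ga, submonoid_lift Gs).
have -> : x = u * v by apply: val_inj; rewrite valM def_u def_v.
have /monoid_closedP[_ genM] := generated_closed ((val : S -> K) @^-1` A).
apply: genM; last by apply: IHs => // b bs; apply: sA; rewrite in_cons bs orbT.
by apply: mem_generated; rewrite /= def_u; apply: sA; rewrite mem_head.
Qed.

Lemma atomic_submonoid : atomic K -> atomic S.
Proof.
move=> [genK boundK]; split=> [|x].
  apply/seteqP; split=> // x _.
  have -> : @atom S = (val : S -> K) @^-1` @atom K.
    by apply/seteqP; split=> y /atom_val.
  by apply: generated_val; rewrite genK.
have [n bound_n] := boundK (val x); exists n => s s_atom def_x.
rewrite -(size_map val); apply: bound_n => [_ /mapP[a /s_atom a_atom ->]|].
  exact/atom_val.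
rewrite big_map -def_x; apply/esym; apply: (big_morph (val : S -> K)); [exact: valM | exact: val1].
Qed.

Variable Delta : K.
Hypothesis garsideK : garside_structure Delta.
Hypothesis prefixG : forall k, exists g, greatest_below (@is_prefix K) G k g.
Hypothesis suffixG : forall k, exists g, greatest_below (@is_suffix K) G k g.

Lemma balanced_greatest :
  exists delta, greatest_below (@is_prefix K) G Delta delta
             /\ greatest_below (@is_suffix K) G Delta delta.
Proof.
have [_ atomicK _ _ balD _ _] := garsideK.
have prefE k : is_prefix k Delta <-> is_suffix k Delta.
  by rewrite -[is_prefix k _]/(Div Delta k) balD.
have [[d1 great1] [d2 great2]] := (prefixG Delta, suffixG Delta).
have [[G1 D1 max1] [G2 D2 max2]] := (great1, great2).
have [u def2] : is_suffix d1 d2 by apply: max2 => //; apply/prefE.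
have [v def1] : is_prefix d2 d1 by apply: max1 => //; apply/prefE.
(* Substituting [d1 = d2 * v] into [d2 = u * d1] gives [d2 = u * d2 * v]. *)
have [_ v1] : u = 1 /\ v = 1 by apply: (atomic_mul_eq atomicK (x := d2)); rewrite -mulgA -def1.
by exists d1; split=> //; rewrite def1 v1 mulg1.
Qed.

Lemma Div_greatest delta :
  greatest_below (@is_prefix K) G Delta delta -> Div delta = Div Delta `&` G.
Proof.
move=> [Gd dD max_d]; apply/seteqP; split=> [x xd|x [xD Gx]]; last exact: max_d.
split; last by have [u def_d] := xd; apply: (@facG x u _).1; rewrite -def_d.
exact: (lattice_trans (garside_prefix_lattice garsideK)) xd dD.
Qed.

(** Since [Delta] is balanced, the prefixes and the suffixes of [delta] are both the simple elements
    lying in [G]. *)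
Lemma balanced_delta delta :
  greatest_below (@is_prefix K) G Delta delta ->
  greatest_below (@is_suffix K) G Delta delta -> balanced delta.
Proof.
move=> pref_d [Gd dD max_d]; have balD := garside_balanced garsideK.
rewrite /balanced (Div_greatest pref_d) balD; apply/seteqP; split=> [x [xD Gx]|x xd].
  exact: max_d.
split; last by have [u def_d] := xd; apply: (@facG u x _).2; rewrite -def_d.
exact: (lattice_trans (garside_suffix_lattice garsideK)) xd dD.
Qed.

(** An atom written as a product of simple elements is one of them. *)
Lemma atom_prefix_Delta (a : K) : atom a -> is_prefix a Delta.
Proof.
move=> atom_a; have : generated (Div Delta) a by rewrite (garside_generated garsideK).
by case/generatedP=> s sD def_a; apply/sD/atom_mem_prod.
Qed.

Lemma parabolic_gen_greatest delta :
  greatest_below (@is_prefix K) G Delta delta -> G = parabolic_gen delta.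
Proof.
move=> great_d; have DivE := Div_greatest great_d; apply/seteqP; split=> [g Gg|].
  have [s s_atom def_g] := atomic_decomp (garside_atomic garsideK) g.
  apply/generatedP; exists s => // a as_; split; first exact: s_atom.
  rewrite -[is_prefix a _]/(Div delta a) DivE; split; first exact/atom_prefix_Delta/s_atom.
  (* Factor closure puts each letter of a word for [g] in [G]. *)
  move: Gg; rewrite -def_g; elim: s {s_atom def_g} as_ => //= b s IHs.
  rewrite big_cons in_cons => as_ /facG[Gb Gs].
  by move: as_ => /orP[/eqP->|/IHs]; last exact.
apply: generated_subset => // a [_]; rewrite -[is_prefix a _]/(Div delta a) DivE.
by case.
Qed.

Lemma parabolic_factor_closed : parabolic Delta G.
Proof.
have [d [pref_d suff_d]] := balanced_greatest.
exists d; rewrite -(parabolic_gen_greatest pref_d); split=> //.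
- exact: balanced_delta.
- by have [] := pref_d.
- exact: Div_greatest.
Qed.

Lemma garside_factor_closed : garside_monoid S.
Proof.
have [delta [pref_d suff_d]] := balanced_greatest.
have [Gd _ _] := pref_d; have [d def_d] := submonoid_lift Gd.
(* The divisors of [d] in [S] are thus all simple elements of [K] lying in [G], so generation and
   finiteness pull back from [Delta]. *)
have DivE x : Div d x <-> Div Delta (val x).
  rewrite /Div/= is_prefix_val def_d -[is_prefix _ delta]/(Div delta (val x)).
  rewrite (Div_greatest pref_d); split=> [[]|xD] //; split=> //; exact: submonoidP.
have [[injl injr] atomicK prefK suffK balD genD finD] := garsideK.
exists d; split.
- split=> [z x y|z x y] eq_xy; apply: val_inj.
    by apply: (injl (val z)); have := congr1 val eq_xy; rewrite !valM.
  by apply: (injr (val z)); have := congr1 val eq_xy; rewrite !valM.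
- exact: atomic_submonoid.
- apply: (lattice_order_sub val_inj range_submonoid_val is_prefix_val) prefK => //.
  by move=> k l Gl [u def_l]; apply: (@facG k u _).1; rewrite -def_l.
- apply: (lattice_order_sub val_inj range_submonoid_val is_suffix_val) suffK => //.
  by move=> k l Gl [u def_l]; apply: (@facG u k _).2; rewrite -def_l.
- have bald := balanced_delta pref_d suff_d.
  apply/seteqP; split=> x; rewrite /Div /= is_prefix_val is_suffix_val def_d.
    by rewrite -[is_prefix _ _]/(Div delta (val x)) bald.
  by rewrite -[is_prefix _ _]/(Div delta (val x)) bald.
- apply/seteqP; split=> // x _.
  have -> : Div d = (val : S -> K) @^-1` Div Delta by apply/seteqP; split=> y /DivE.
  by apply: generated_val; rewrite genD.
- have -> : Div d = (val : S -> K) @^-1` Div Delta by apply/seteqP; split=> y /DivE.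
  by apply: finite_preimage finD => x y _ _; apply: val_inj.
Qed.

End FactorClosed.

(** * Factors of a Zappa-Szép product *)

Section ZappaSzep.
Variables (K : monoidType) (G H : set K).
Hypotheses (hG : monoid_closed [in G]) (hH : monoid_closed [in H]).
Hypothesis hGH : zappa_szep G H.

Lemma zappa_szep_uniq_GH g1 h1 g2 h2 :
  G g1 -> H h1 -> G g2 -> H h2 -> g1 * h1 = g2 * h2 -> g1 = g2 /\ h1 = h2.
Proof.
move=> G1 H1 G2 H2 e; have [[p [_ uniq_p]] _] := hGH (g1 * h1).
have := uniq_p (g1, h1) (And3 G1 H1 erefl).
by rewrite (uniq_p (g2, h2) (And3 G2 H2 (esym e))) => -[].
Qed.

Lemma zappa_szep_uniq_HG h1 g1 h2 g2 :
  H h1 -> G g1 -> H h2 -> G g2 -> h1 * g1 = h2 * g2 -> h1 = h2 /\ g1 = g2.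
Proof.
move=> H1 G1 H2 G2 e; have [_ [p [_ uniq_p]]] := hGH (h1 * g1).
have := uniq_p (h1, g1) (And3 H1 G1 erefl).
by rewrite (uniq_p (h2, g2) (And3 H2 G2 (esym e))) => -[].
Qed.

Lemma zappa_szep_GH k : exists g h, [/\ G g, H h & k = g * h].
Proof. by have [[[g h] [[Gg Hh <-] _]] _] := hGH k; exists g, h. Qed.

Lemma zappa_szep_HG k : exists h g, [/\ H h, G g & k = h * g].
Proof. by have [_ [[h g] [[Hh Gg <-] _]]] := hGH k; exists h, g. Qed.

Lemma zappa_szep_factor_closed : atomic K -> factor_closed G.
Proof.
have [/monoid_closedP[G1 GM] /monoid_closedP[H1 HM]] := (hG, hH).
move=> atomicK x y Gxy.
have [g [h [Gg Hh def_x]]] := zappa_szep_GH x.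
have [g' [h' [Gg' Hh' def_hy]]] := zappa_szep_GH (h * y).
(* Compare [(x * y) * 1] with [(g * g') * h']: this shows that [h * y = g'] lies in [G]. *)
have [_ h'1] : x * y = g * g' /\ 1 = h'.
  by apply: zappa_szep_uniq_GH; rewrite ?mulg1 -?mulgA -?def_hy ?mulgA -?def_x //; exact: GM.
have [h2 [g2 [Hh2 Gg2 def_y]]] := zappa_szep_HG y.
(* Now [(h * h2) * g2 = 1 * g'], and conicality kills both [h] and [h2], leaving [x = g] and
   [y = g2]. *)
have [/atomic_conical[//|h_1 h2_1] _] : h * h2 = 1 /\ g2 = g'.
  apply: zappa_szep_uniq_HG; rewrite ?mul1g //; first exact: HM.
  by rewrite -mulgA -def_y def_hy -h'1 mulg1.
by rewrite def_x def_y h_1 h2_1 mulg1 mul1g.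
Qed.

(** If [k = x * l] with [x] in [G] and [l = g' * h'], then uniqueness identifies the [G]-part of [k]
    with [x * g']. *)
Lemma zappa_szep_prefix k : exists g, greatest_below (@is_prefix K) G k g.
Proof.
have [_ GM] := (monoid_closedP G).1 hG.
have [g [h [Gg Hh def_k]]] := zappa_szep_GH k.
exists g; split=> //; first by exists h.
move=> x Gx [l def_kx]; have [g' [h' [Gg' Hh' def_l]]] := zappa_szep_GH l.
have [-> _] : g = x * g' /\ h = h'; last by exists g'.
by apply: zappa_szep_uniq_GH => //; [exact: GM | rewrite -mulgA -def_l -def_kx].
Qed.

Lemma zappa_szep_suffix k : exists g, greatest_below (@is_suffix K) G k g.
Proof.
have [_ GM] := (monoid_closedP G).1 hG.
have [h [g [Hh Gg def_k]]] := zappa_szep_HG k.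
exists g; split=> //; first by exists h.
move=> x Gx [l def_kx]; have [h' [g' [Hh' Gg' def_l]]] := zappa_szep_HG l.
have [_ ->] : h = h' /\ g = g' * x; last by exists g'.
by apply: zappa_szep_uniq_HG => //; [exact: GM | rewrite mulgA -def_l -def_kx].
Qed.

Lemma zappa_szep_parabolic_garside (Delta : K) : garside_structure Delta ->
  parabolic Delta G /\ garside_monoid (submonoid_type hG).
Proof.
move=> hDelta; have facG := zappa_szep_factor_closed (garside_atomic hDelta).
split; [apply: parabolic_factor_closed | apply: garside_factor_closed hDelta _ _] => //.
all: solve [exact: zappa_szep_prefix | exact: zappa_szep_suffix].
Qed.

End ZappaSzep.

Lemma zappa_szep_sym (K : monoidType) (G H : set K) :
  zappa_szep G H -> zappa_szep H G.
Proof. by move=> hGH k; have [] := hGH k. Qed.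

Theorem theorem34 (K : monoidType) (G H : set K)
    (hG : monoid_closed [in G]) (hH : monoid_closed [in H])
    (hGH : zappa_szep G H) (Delta : K) (hDelta : garside_structure Delta) :
  (parabolic Delta G /\ parabolic Delta H) /\
  (garside_monoid (submonoid_type hG) /\ garside_monoid (submonoid_type hH)).
Proof.
have [parG garG] := zappa_szep_parabolic_garside hG hH hGH hDelta.
(* Decompositions exist in both orders, so the roles of [G] and [H] can be exchanged. *)
by have [parH garH] := zappa_szep_parabolic_garside hH hG (zappa_szep_sym hGH) hDelta.
Qed.
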